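(* Let $b\in\mathbb{R}^n\setminus\mathbb{Z}^n$ and let $P\subseteq\mathbb{R}^n$ be finite such that $C^P\neq\emptyset$. Then the following are equivalent: (a) $P\subseteq\mathbb{Q}^n$; (b) $\operatorname{rec}(C^P)=\mathbb{R}^P_+$; (c) the dimension of $C^P$ is $|P|$; (d) $C^P=G_b\cap V_P$.
   Context: $\mathbb{R}^{(\mathbb{R}^n)}$ is the real vector space of functions $\mathbb{R}^n\to\mathbb{R}$ with finite support, $\mathbb{R}^{(\mathbb{R}^n)}_+$ the subset of its nonnegative functions. $M_b$ is the set of all pairs $(s,y)$ of finite-support functions $s:\mathbb{R}^n\to\mathbb{R}_+$, $y:\mathbb{R}^n\to\mathbb{Z}_+$ such that $\sum_{r} r\,s(r)+\sum_{p}p\,y(p)\in b+\mathbb{Z}^n$, and $I_b=\{y:(0,y)\in M_b\}$. For $P\subseteq\mathbb{R}^n$, $V_P=\{y\in\mathbb{R}^{(\mathbb{R}^n)}:y(p)=0\ \forall p\notin P\}$, identified for finite $P$ with $\mathbb{R}^P$ by dropping the variables set to $0$, and $C^P=\operatorname{conv}(I_b)\cap V_P$ (conv is the convex hull). A tuple $(\psi,\pi,\alpha)$ with $\psi,\pi:\mathbb{R}^n\to\mathbb{R}$, $\alpha\in\{-1,0,1\}$ is a valid tuple for $M_b$ if $\sum_r\psi(r)s(r)+\sum_p\pi(p)y(p)\ge\alpha$ for all $(s,y)\in M_b$. $Q_b$ is the set of all $(s,y)\in\mathbb{R}^{(\mathbb{R}^n)}_+\times\mathbb{R}^{(\mathbb{R}^n)}_+$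 satisfying $\sum_r\psi(r)s(r)+\sum_p\pi(p)y(p)\ge\alpha$ for every valid tuple $(\psi,\pi,\alpha)$ for $M_b$, and $G_b=\{y\in\mathbb{R}^{(\mathbb{R}^n)}:(0,y)\in Q_b\}$. $\operatorname{rec}(C)=\bigcap_{x\in C}\{r:x+\lambda r\in C\ \forall\lambda\ge0\}$ is the recession cone. *)

(* Defs.v *)
From HB Require Import structures.
From mathcomp Require Import all_boot all_order all_algebra finmap.
From mathcomp Require Import all_classical all_reals all_analysis.

Set Implicit Arguments.
Unset Strict Implicit.
Unset Printing Implicit Defensive.
Import Order.TTheory GRing.Theory Num.Theory.
Import numFieldNormedType.Exports.

Local Open Scope classical_set_scope.
Local Open Scope ring_scope.

Section ConvexGeometry.
Context {R : realType} {V : lmodType R}.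

Definition conv_hull (A : set V) : set V := smallest (@convex_set R V) A.

Definition rec_cone (A : set V) : set V :=
  \bigcap_(x in A) [set r | forall l : R, 0 <= l -> A (x + l *: r)].

Definition affine_set (A : set V) : Prop :=
  forall (x y : V) (t : R), A x -> A y -> A (t *: x + (1 - t) *: y).

Definition aff_hull (A : set V) : set V := smallest affine_set A.

End ConvexGeometry.

(* [has_dim A d]: the affine hull of [A] is a translate of a linear subspace of
   dimension [d]; in particular the empty set has no dimension. *)
Definition has_dim {R : realType} {V : vectType R} (A : set V) (d : nat) : Prop :=
  exists (x : V) (U : {vspace V}),
    aff_hull A = [set x + u | u in [set u | u \in U]] /\ \dim U = d.

Section MixedIntegerInfiniteGroup.
Context {R : realType} {n : nat}.

Notation Rn := 'rV[R]_n.

Definition Zn : set Rn := [set x | forall i, x 0 i \is a Num.int].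

Definition Qn : set Rn := [set x | forall i, rational (x 0 i)].

(* The space of finite-support functions R^n -> R is represented by the
   predicate [finsupp] on the R-vector space of all functions. *)
Definition finsupp : set (Rn -> R) := [set f | finite_set [set x | f x != 0]].

Definition finsupp_ge0 : set (Rn -> R) :=
  [set f | finsupp f /\ forall x, 0 <= f x].

(* All sums over [setT] below have finitely many nonzero terms, since [s] and
   [y] have finite support; a sum [\sum_(_ \in _)] with infinitely many nonzero
   terms would be 0 by convention. *)
Definition Mb (b : Rn) : set ((Rn -> R) * (Rn -> R)) :=
  [set sy | [/\ finsupp_ge0 sy.1,
                finsupp_ge0 sy.2,
                forall p, sy.2 p \is a Num.nat &
                Zn (\sum_(r \in [set: Rn]) sy.1 r *: r
                    + \sum_(p \in [set: Rn]) sy.2 p *: p - b)]].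

Definition Ib (b : Rn) : set (Rn -> R) := [set y | Mb b (0, y)].

Definition tuple_ineq (psi pi : Rn -> R) (alpha : R)
    (sy : (Rn -> R) * (Rn -> R)) : Prop :=
  alpha <= \sum_(r \in [set: Rn]) psi r * sy.1 r
           + \sum_(p \in [set: Rn]) pi p * sy.2 p.

Definition valid_tuple (b : Rn) (psi pi : Rn -> R) (alpha : R) : Prop :=
  [\/ alpha = -1, alpha = 0 | alpha = 1] /\
  forall sy, Mb b sy -> tuple_ineq psi pi alpha sy.

Definition Qb (b : Rn) : set ((Rn -> R) * (Rn -> R)) :=
  [set sy | [/\ finsupp_ge0 sy.1, finsupp_ge0 sy.2 &
                forall psi pi alpha, valid_tuple b psi pi alpha ->
                  tuple_ineq psi pi alpha sy]].

Definition Gb (b : Rn) : set (Rn -> R) := [set y | finsupp y /\ Qb b (0, y)].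

Definition VP (P : set Rn) : set (Rn -> R) :=
  [set y | finsupp y /\ forall p, ~ P p -> y p = 0].

Definition CP (b : Rn) (P : set Rn) : set (Rn -> R) := conv_hull (Ib b) `&` VP P.

(* Dropping the variables outside [P]; on [VP [set` P]] this is the
   identification with R^P. [R^o] is [R] as a vector space over itself. *)
Definition restr (P : {fset Rn}) (y : Rn -> R) : {ffun P -> R^o} :=
  [ffun p => y (val p)].

Definition CP_R (b : Rn) (P : {fset Rn}) : set {ffun P -> R^o} :=
  restr P @` CP b [set` P].

Definition orthant (P : {fset Rn}) : set {ffun P -> R^o} :=
  [set f | forall p, 0 <= (f p : R)].

End MixedIntegerInfiniteGroup.

Arguments restr {R n} P y.
Arguments CP_R {R n} b P.
Arguments orthant {R n} P.

(* Main.v *)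
(* The value of an integer combination of [P] modulo Z^n only depends on the
   coefficients modulo a common denominator D of P, when P is rational. Then
   conv(I_b) is invariant under the rays of R_+^P, hence full-dimensional.
   Conversely, full dimension gives an integer matrix of full rank mapping the
   points of P into Z^n, hence P is rational.

   For rational P, conv(I_b) in V_P is generated by finitely many residues
   modulo D and the rays of R_+^P, so a point y outside it is separated from it
   by some x > 0 on P (Gordan's theorem). Putting pi = x on P, pi = 1 outside P
   and psi a large multiple of the l1-norm gives a valid tuple, since the
   continuous part either vanishes or is bounded away from 0; it cuts off y from
   G_b. If P is not assumed rational, Dirichlet approximation, with the small
   error absorbed by s, shows that every valid tuple has pi >= 0. So G_b is
   invariant under all rays, and equality in (d) forces full dimension. *)
Require Import Defs.
From mathcomp Require Import all_boot all_order all_algebra finmap.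
From mathcomp Require Import all_classical all_reals all_analysis.
From mathcomp Require Import ring lra zify.

Set Implicit Arguments.
Unset Strict Implicit.
Unset Printing Implicit Defensive.
Import Order.TTheory GRing.Theory Num.Theory.

Local Open Scope classical_set_scope.
Local Open Scope ring_scope.

(* [finmap] shadows this name with the support of an [fsfun]. *)
Local Notation finsupp := Defs.finsupp.

(** * Finite-support functions and their weighted sums *)

Section FiniteSums.
Context {R : realType} {n : nat}.
Implicit Types (f g : 'rV[R]_n -> R) (p : 'rV[R]_n).

(** One notion covers both kinds of sum in [Mb] and [tuple_ineq]: [h = id] gives the vector tested
    against the lattice, while [h = psi] or [h = pi] gives a side of a linear inequality. *)
Definition wsum {V : lmodType R} (h : 'rV[R]_n -> V) f : V :=
  \sum_(p \in [set: 'rV[R]_n]) f p *: h p.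

Definition unit_at p : 'rV[R]_n -> R := fun q => (q == p)%:R.

Lemma finsuppP f :
  finsupp f <-> exists A : {fset 'rV[R]_n}, forall p, p \notin A -> f p = 0.
Proof.
split=> [/finite_fsetP[A fA]|[A fA]].
  exists A => p; apply: contraNeq => fp.
  by have : [set x | f x != 0] p by []; rewrite fA.
apply: (finite_subfset A) => p /=; apply: contraR => /fA ->.
by rewrite eqxx.
Qed.

Lemma wsumE {V : lmodType R} (h : 'rV[R]_n -> V) f (A : {fset 'rV[R]_n}) :
  (forall p, p \notin A -> f p = 0) -> wsum h f = \sum_(p <- A) f p *: h p.
Proof. by move=> fA; apply: fsbigTE => p /fA ->; rewrite scale0r. Qed.

Lemma finsupp0 : finsupp (0 : 'rV[R]_n -> R).
Proof. by apply/finsuppP; exists fset0. Qed.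

Lemma finsuppD f g : finsupp f -> finsupp g -> finsupp (f + g).
Proof.
move=> /finsuppP[A fA] /finsuppP[B gB]; apply/finsuppP.
exists (A `|` B)%fset => p; rewrite !inE negb_or => /andP[/fA fp /gB gp].
by rewrite fctE fp gp addr0.
Qed.

Lemma finsuppZ (c : R) f : finsupp f -> finsupp (c *: f).
Proof.
move=> /finsuppP[A fA]; apply/finsuppP; exists A => p /fA fp.
by rewrite fctE fp scaler0.
Qed.

Lemma finsupp_unit_at p : finsupp (unit_at p).
Proof.
apply/finsuppP; exists [fset p]%fset => q; rewrite !inE /unit_at.
by move=> /negbTE ->.
Qed.

Section Wsum.
Context {V : lmodType R}.
Implicit Types h : 'rV[R]_n -> V.

Lemma wsum0 h : wsum h 0 = 0.
Proof. by apply: fsbig1 => p _; rewrite scale0r. Qed.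

Lemma wsumD h f g : finsupp f -> finsupp g ->
  wsum h (f + g) = wsum h f + wsum h g.
Proof.
move=> /finsuppP[A fA] /finsuppP[B gB].
rewrite !(@wsumE _ _ _ (A `|` B)%fset); first last.
- by move=> p; rewrite !inE negb_or => /andP[/fA fp /gB gp]; rewrite fctE fp gp addr0.
- by move=> p; rewrite !inE negb_or => /andP[/fA].
- by move=> p; rewrite !inE negb_or => /andP[_ /gB].
rewrite -big_split /=; apply: eq_bigr => p _.
by rewrite fctE scalerDl.
Qed.

Lemma wsumZ h (c : R) f : finsupp f -> wsum h (c *: f) = c *: wsum h f.
Proof.
move=> /finsuppP[A fA]; rewrite !(@wsumE _ _ _ A) //; last first.
  by move=> p /fA fp; rewrite fctE fp scaler0.
by rewrite scaler_sumr; apply: eq_bigr => p _; rewrite scalerA.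
Qed.

Lemma wsum_unit_at h p : wsum h (unit_at p) = h p.
Proof.
rewrite (@wsumE _ _ _ [fset p]%fset) ?big_seq_fset1 /unit_at ?eqxx ?scale1r //.
by move=> q; rewrite !inE => /negbTE ->.
Qed.

(** Finite support is proved together with the value because additivity needs it in the inductive
    step. The points [a i] may coincide. *)
Lemma wsum_sum h (I : Type) (r : seq I) (c : I -> R) (a : I -> 'rV[R]_n) :
  finsupp (\sum_(i <- r) c i *: unit_at (a i)) /\
  wsum h (\sum_(i <- r) c i *: unit_at (a i)) = \sum_(i <- r) c i *: h (a i).
Proof.
elim: r => [|i r [IHs IHw]].
  by rewrite !big_nil wsum0; split => //; exact: finsupp0.
have si := finsuppZ (c i) (finsupp_unit_at (a i)).
rewrite !big_cons wsumD // wsumZ ?wsum_unit_at ?IHw; last exact: finsupp_unit_at.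
by split => //; exact: finsuppD.
Qed.

End Wsum.

Lemma wsum_ge0 (h : 'rV[R]_n -> R^o) f :
  (forall p, 0 <= h p) -> (forall p, 0 <= f p) -> 0 <= (wsum h f : R).
Proof. by move=> h0 f0; apply: fsumr_ge0 => p _; apply: mulr_ge0. Qed.

Lemma tuple_ineqE (psi pi : 'rV[R]_n -> R) (alpha : R) f g :
  tuple_ineq psi pi alpha (f, g) <->
  alpha <= (wsum (psi : _ -> R^o) f : R) + (wsum (pi : _ -> R^o) g : R).
Proof.
rewrite /tuple_ineq /wsum /=.
rewrite (eq_fsbigr (fun r => f r *: (psi r : R^o) : R)); last first.
  by move=> r _; rewrite mulrC.
rewrite [X in _ + X](eq_fsbigr (fun r => g r *: (pi r : R^o) : R)) // => r _.
by rewrite mulrC.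
Qed.

Lemma VP_finsupp (P : {fset 'rV[R]_n}) f :
  (forall p, p \notin P -> f p = 0) -> VP [set` P] f.
Proof.
move=> fP; split; first by apply/finsuppP; exists P.
by move=> p /negP/fP.
Qed.

Lemma wsum_VP {V : lmodType R} (h : 'rV[R]_n -> V) (P : {fset 'rV[R]_n}) f :
  VP [set` P] f -> wsum h f = \sum_(p <- P) f p *: h p.
Proof. by move=> [_ fP]; apply: wsumE => p /negP/fP. Qed.

End FiniteSums.

(** * Gordan's theorem of the alternative *)

Section Gordan.
Context {R : realType}.

Lemma exists_between1 (c : R) (B : seq R) :
  (forall b, b \in B -> c < b) -> exists2 t, c < t & forall b, b \in B -> t < b.
Proof.
elim: B => [_|b B IH cB]; first by exists (c + 1); rewrite ?ltrDl ?ltr01.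
have [x xB|t ct tB] := IH; first by apply: cB; rewrite inE xB orbT.
have cb : c < b by apply: cB; rewrite mem_head.
exists (Num.min t ((c + b) / 2)); first by rewrite lt_min ct /=; lra.
move=> x; rewrite inE gt_min => /orP[/eqP ->|/tB ->//].
by apply/orP; right; lra.
Qed.

(** Solves the one-variable strict system left by Fourier-Motzkin elimination; an empty list means
    no bound on that side. *)
Lemma exists_between (A B : seq R) :
  (forall a b, a \in A -> b \in B -> a < b) ->
  exists t, (forall a, a \in A -> a < t) /\ (forall b, b \in B -> t < b).
Proof.
elim: A => [_|a A IH AB].
  exists (- \sum_(b <- B) `|b| - 1); split => // b bB.
  have : - b <= `|b| by rewrite -normrN ler_norm.
  rewrite (perm_big _ (perm_to_rem bB)) /= big_cons.
  have := @sumr_ge0 R _ (rem b B) xpredT (fun b => `|b|) (fun _ _ => normr_ge0 _).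
  lra.
have [x y xA yB|t [At tB]] := IH; first by apply: AB; rewrite // inE xA orbT.
have [t' t't t'B] : exists2 t', Num.max a t < t' & forall b, b \in B -> t' < b.
  apply: exists_between1 => b bB.
  by rewrite gt_max tB // AB // mem_head.
exists t'; split => // x; move: t't; rewrite gt_max inE => /andP[at' tt'].
by move=> /orP[/eqP ->//|/At xt]; exact: lt_trans tt'.
Qed.

(** At least one generator always occurs with a positive weight. The empty combination is excluded,
    as it would make the second alternative of Gordan's theorem trivial. *)
Inductive pos_comb {V : lmodType R} (L : seq V) : V -> Prop :=
| pos_comb_in v : v \in L -> pos_comb L v
| pos_combD v w : pos_comb L v -> pos_comb L w -> pos_comb L (v + w)
| pos_combZ (c : R) v : 0 < c -> pos_comb L v -> pos_comb L (c *: v).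

Lemma pos_comb_trans {V : lmodType R} (L L' : seq V) v :
  (forall a, a \in L' -> pos_comb L a) -> pos_comb L' v -> pos_comb L v.
Proof.
move=> LL'; elim=> {v} [v /LL'//|v w _ IHv _ IHw|c v c0 _ IHv].
- exact: pos_combD.
- exact: pos_combZ.
Qed.

(* Fourier-Motzkin elimination of the coordinates in [s], one at a time. *)
Lemma gordan {T : choiceType} (s : seq T) (L : seq (T -> R)) : uniq s ->
  (exists x : T -> R, forall a, a \in L -> 0 < \sum_(p <- s) a p * x p) \/
  (exists2 v, pos_comb L v & forall p, p \in s -> v p = 0).
Proof.
elim: s L => [|p s IH] L /=.
  case: L => [|a L] _; first by left; exists 0.
  by right; exists a => //; apply: pos_comb_in; rewrite mem_head.
move=> /andP[ps us].
pose Z := [seq a <- L | a p == 0].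
pose A := [seq a <- L | 0 < a p].
pose B := [seq a <- L | a p < 0].
(* The weights turn the coefficients at [p] into 1 and -1, so the coordinate [p] cancels in
   [e a b]. *)
pose e (a b : T -> R) := (a p)^-1 *: a + (- b p)^-1 *: b.
have eL v : v \in Z ++ [seq e a b | a <- A, b <- B] -> pos_comb L v /\ v p = 0.
  rewrite mem_cat => /orP[|/allpairsP[[a b] /= [aA bB ->]]].
    by rewrite mem_filter => /andP[/eqP ? ?]; split => //; exact: pos_comb_in.
  move: aA bB; rewrite !mem_filter => /andP[a0 aL] /andP[b0 bL]; split.
    by apply: pos_combD; apply: pos_combZ; rewrite ?invr_gt0 ?oppr_gt0 //;
      exact: pos_comb_in.
  rewrite /e !fctE /GRing.scale /= invrN mulNr !mulVf ?subrr //.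
  - by rewrite lt_eqF.
  - by rewrite gt_eqF.
have [[x xP]|[v vL v0]] := IH (Z ++ [seq e a b | a <- A, b <- B]) us; last first.
  right; exists v; first by apply: pos_comb_trans vL => a /eL[].
  move=> q; rewrite inE => /orP[/eqP ->|]; last exact: v0.
  elim: vL {v0} => {v} [v /eL[]//|v w _ IHv _ IHw|c v c0 _ IHv].
  - by rewrite fctE IHv IHw addr0.
  - by rewrite fctE IHv scaler0.
left; pose D (a : T -> R) := \sum_(q <- s) a q * x q.
(* [t] is to be the value of the solution at [p]: rows in [A] bound it from below, rows in [B] from
   above, and the bounds are compatible because [0 < D (e a b)]. *)
have [t [At tB]] : exists t,
    (forall u, u \in [seq - (D a / a p) | a <- A] -> u < t) /\
    (forall u, u \in [seq D b / - b p | b <- B] -> t < u).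
  apply: exists_between => _ _ /mapP[a aA ->] /mapP[b bB ->].
  have : 0 < D (e a b).
    by apply: xP; rewrite mem_cat allpairs_f ?orbT.
  suff -> : D (e a b) = D a / a p + D b / - b p by lra.
  rewrite /D !mulr_suml -big_split /=; apply: eq_bigr => q _.
  by rewrite /e !fctE /GRing.scale /=; ring.
exists (fun q => if q == p then t else x q) => a aL.
rewrite big_cons eqxx.
have -> : \sum_(q <- s) a q * (if q == p then t else x q) = D a.
  apply: eq_big_seq => q qs; case: eqP => // qp.
  by move: ps; rewrite -qp qs.
have [a0|a0|a0] := ltgtP (a p) 0.
- have := tB _ (map_f (fun b => D b / - b p) (_ : a \in B)).
  rewrite mem_filter a0 aL => /(_ isT).
  by rewrite ltr_pdivlMr ?oppr_gt0 //; lra.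
- have := At _ (map_f (fun a => - (D a / a p)) (_ : a \in A)).
  rewrite mem_filter a0 aL => /(_ isT).
  by rewrite -mulNr ltr_pdivrMr //; lra.
- by rewrite a0 mul0r add0r; apply: xP; rewrite mem_cat mem_filter a0 eqxx aL.
Qed.

End Gordan.

(** * Convex hulls *)

Section Convexity.
Context {R : realType} {V : lmodType R}.
Implicit Types A X : set V.

Lemma convex_setE X : @convex_set R V X <->
  forall x y (t : R), 0 <= t -> t <= 1 -> X x -> X y -> X (t *: x + (1 - t) *: y).
Proof.
split=> [cX x y t t0 t1 Xx Xy|cX x y l].
  by have := cX x y (Itv01 t0 t1); rewrite !inE; apply.
by rewrite !inE => Xx Xy; apply: cX.
Qed.

Lemma conv_hull_ind A X :
  (forall x y (t : R), 0 <= t -> t <= 1 -> X x -> X y ->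
    X (t *: x + (1 - t) *: y)) ->
  A `<=` X -> conv_hull A `<=` X.
Proof. by move=> /convex_setE cX AX; exact: smallest_sub. Qed.

Lemma conv_hull_convex A x y (t : R) : 0 <= t -> t <= 1 ->
  conv_hull A x -> conv_hull A y -> conv_hull A (t *: x + (1 - t) *: y).
Proof.
move=> t0 t1 Ax Ay X [cX AX]; move/convex_setE: (cX); apply => //.
- exact: Ax.
- exact: Ay.
Qed.

Lemma sub_conv_hull A : A `<=` conv_hull A.
Proof. exact: sub_gen_smallest. Qed.

End Convexity.

(** * The integer lattice: simultaneous approximation and common denominators *)

Section Lattice.
Context {R : realType} {n : nat}.
Implicit Types (x y p : 'rV[R]_n).

Lemma Zn0 : Zn (0 : 'rV[R]_n).
Proof. by move=> i; rewrite mxE. Qed.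

Lemma ZnD x y : Zn x -> Zn y -> Zn (x + y).
Proof. by move=> xZ yZ i; rewrite mxE rpredD. Qed.

Lemma ZnN x : Zn x -> Zn (- x).
Proof. by move=> xZ i; rewrite mxE rpredN. Qed.

Lemma ZnMn (m : nat) x : Zn x -> Zn (m%:R *: x).
Proof. by move=> xZ i; rewrite mxE rpredM ?rpred_nat. Qed.

(** Pigeonhole: the fractional parts of the multiples of [p] fall into finitely many cubes of side
    [N.+1%:R^-1 < eps]. Two multiples in the same cube differ by a vector within [eps] of an integer
    one. *)
Lemma dirichlet_approximation p (eps : R) : 0 < eps ->
  exists (k : nat) (z : 'rV[R]_n),
    [/\ (0 < k)%N, Zn z & forall i, `|z 0 i - k%:R * p 0 i| <= eps].
Proof.
move=> eps0; pose N := Num.truncn eps^-1.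
have N_eps : N.+1%:R^-1 < eps :> R.
  by rewrite invf_plt ?posrE ?ltr0Sn ?truncnS_gt.
pose fl (k : nat) i := (Num.floor (k%:R * p 0 i))%:~R : R.
pose fr (k : nat) i := k%:R * p 0 i - fl k i.
pose cell (k : 'I_(#|{ffun 'I_n -> 'I_N.+1}|.+1)) : {ffun 'I_n -> 'I_N.+1} :=
  [ffun i => inord (Num.truncn (N.+1%:R * fr k i))].
have fr_itv k i : 0 <= fr k i < 1.
  by have := floor_itv (k%:R * p 0 i); rewrite intrD /fr /fl; lra.
have cell_fr k k' i : cell k = cell k' -> `|fr k i - fr k' i| <= N.+1%:R^-1.
  have trP j : 0 <= N.+1%:R * fr j i.
    by case/andP: (fr_itv j i) => *; rewrite mulr_ge0.
  have ltN j : (Num.truncn (N.+1%:R * fr j i) < N.+1)%N.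
    rewrite truncn_lt_nat //; case/andP: (fr_itv j i) => _ fr1.
    by rewrite -[ltRHS]mulr1 ltr_pM2l ?ltr0Sn.
  move=> /ffunP/(_ i); rewrite !ffunE => /(congr1 val) /=.
  rewrite !inordK // => e.
  have := truncn_itv (trP k); have := truncn_itv (trP k'); rewrite e => t' t.
  rewrite -(ler_pM2l (ltr0Sn R N)) mulfV ?pnatr_eq0 //.
  rewrite -[X in X * `|_|]gtr0_norm ?ltr0Sn // -normrM mulrBr ler_norml.
  by move: t t'; rewrite -[in X in X -> _]natr1 -[in X in _ -> X -> _]natr1; lra.
have /injectivePn[k [k' kk' ckk']] : ~~ injectiveb cell.
  apply/negP => /injectiveP/leq_card.
  by rewrite card_ord ltnn.
wlog lt_kk' : k k' kk' ckk' / (k < k')%N.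
  move=> H; move: (kk'); rewrite -val_eqE neq_ltn => /orP[] lt; first exact: H lt.
  by apply: H lt; rewrite // eq_sym.
exists (k' - k)%N, (\row_i (fl k' i - fl k i)); split.
- by rewrite subn_gt0.
- by move=> i; rewrite mxE rpredB // intr_int.
- move=> i; rewrite mxE; apply: le_trans (ltW N_eps).
  apply: le_trans (cell_fr k k' i ckk'); rewrite natrB 1?ltnW // le_eqVlt.
  by apply/orP; left; rewrite /fr; apply/eqP; congr `|_|; ring.
Qed.

Lemma common_denominator (P : {fset 'rV[R]_n}) : [set` P] `<=` Qn ->
  exists2 D : nat, (0 < D)%N & forall p, p \in P -> Zn (D%:R *: p).
Proof.
move=> PQ.
have den (x : R) : rational x -> {d : nat | (0 < d)%N & d%:R * x \is a Num.int}.
  (* The representation may have denominator 0, in which case [x] is 0 and 1 serves as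
     denominator. *)
  move=> /rationalP xQ; apply: cid2; case: xQ => a [[|d] ->].
    by exists 1%N; rewrite // invr0 mulr0 mulr0 rpred0.
  by exists d.+1; rewrite // mulrC divfK ?pnatr_eq0 ?intr_int.
pose d (pi : P * 'I_n) := s2val (den _ (PQ _ (fsvalP pi.1) pi.2)).
exists (\prod_pi d pi)%N.
  by rewrite prodn_gt0 // => pi; exact: (s2valP (den _ _)).
move=> p pP i; rewrite mxE (bigD1 ([` pP]%fset, i)) //= mulnC natrM -mulrA.
by rewrite rpredM ?rpred_nat //; exact: (s2valP' (den _ _)).
Qed.

End Lattice.

(** * Integer points, the closure [Gb], and nonnegativity of [pi] *)

Section InfiniteGroup.
Context {R : realType} {n : nat} (b : 'rV[R]_n).
Implicit Types (y r : 'rV[R]_n -> R) (p : 'rV[R]_n) (P : {fset 'rV[R]_n}).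

Lemma finsupp_ge0D y r : finsupp_ge0 y -> finsupp_ge0 r -> finsupp_ge0 (y + r).
Proof.
move=> [fy y0] [fr r0]; split; first exact: finsuppD.
by move=> p; rewrite fctE addr_ge0.
Qed.

Lemma finsupp_ge0Z (c : R) y : 0 <= c -> finsupp_ge0 y -> finsupp_ge0 (c *: y).
Proof.
move=> c0 [fy y0]; split; first exact: finsuppZ.
by move=> p; rewrite fctE mulr_ge0.
Qed.

Lemma finsupp_ge0_0 : finsupp_ge0 (0 : 'rV[R]_n -> R).
Proof. by split=> // ; exact: finsupp0. Qed.

Lemma finsupp_ge0_unit_at p : finsupp_ge0 (unit_at p).
Proof. by split=> [|q]; [exact: finsupp_unit_at | exact: ler0n]. Qed.

Lemma IbE y : Ib b y <->
  [/\ finsupp_ge0 y, forall p, y p \is a Num.nat & Zn (wsum id y - b)].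
Proof.
rewrite /Ib /Mb /=; have -> : \sum_(r \in [set: 'rV[R]_n]) (0 : 'rV[R]_n -> R) r *: r = 0.
  exact: (@wsum0 _ _ _ id).
rewrite add0r; split=> [[_ ? ? ?]|[? ? ?]]; first by split.
by split => //; exact: finsupp_ge0_0.
Qed.

Lemma GbE y : Gb b y <-> finsupp_ge0 y /\
  forall psi pi alpha, valid_tuple b psi pi alpha ->
    alpha <= (wsum (pi : _ -> R^o) y : R).
Proof.
split=> [[_ [_ y0 yP]]|[y0 yP]].
  by split => // psi pi alpha /yP/tuple_ineqE; rewrite wsum0 add0r.
split; first by case: y0.
split; [exact: finsupp_ge0_0|exact: y0|].
by move=> psi pi alpha /yP h; apply/tuple_ineqE; rewrite wsum0 add0r.
Qed.

Lemma Ib_sub_Gb : Ib b `<=` Gb b.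
Proof.
move=> y yI; apply/GbE; split; first by case/IbE: yI.
by move=> psi pi alpha [_ /(_ _ yI)/tuple_ineqE]; rewrite wsum0 add0r.
Qed.

Lemma conv_hull_Ib_sub_Gb : conv_hull (Ib b) `<=` Gb b.
Proof.
apply: conv_hull_ind; last exact: Ib_sub_Gb.
move=> x y t t0 t1 /GbE[x0 xP] /GbE[y0 yP]; apply/GbE.
have t1' : 0 <= 1 - t by lra.
split; first by apply: finsupp_ge0D; apply: finsupp_ge0Z.
move=> psi pi alpha v; have := xP _ _ _ v; have := yP _ _ _ v.
case: x0 y0 => [fx _] [fy _].
rewrite wsumD; [|exact: finsuppZ|exact: finsuppZ].
rewrite !wsumZ //; set u := wsum _ x; set w := wsum _ y => aw au.
have := ler_wpM2l t0 au; have := ler_wpM2l t1' aw.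
by rewrite /GRing.scale /=; lra.
Qed.

Lemma CP_sub_Gb (P : set 'rV[R]_n) : CP b P `<=` Gb b `&` VP P.
Proof. by move=> y [/conv_hull_Ib_sub_Gb]. Qed.

Lemma CP_ge0 (P : set 'rV[R]_n) y p : CP b P y -> 0 <= y p.
Proof. by move=> /CP_sub_Gb[/GbE[[_ +] _] _]; apply. Qed.

Lemma Ib_neq0 (P : set 'rV[R]_n) : CP b P !=set0 -> Ib b !=set0.
Proof.
move=> [y [yC _]]; apply: contrapT => I0.
apply: (@conv_hull_ind _ _ (Ib b) set0 _ _ y yC) => // z zI.
by apply: I0; exists z.
Qed.

(* Since [conv (Ib b)] lies in the nonnegative orthant, [VP P] cuts out a face. *)
Lemma CP_sub_conv_hull (P : set 'rV[R]_n) :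
  CP b P `<=` conv_hull (Ib b `&` VP P).
Proof.
move=> y [yI]; move: y yI.
suff : conv_hull (Ib b) `<=`
    [set y | finsupp_ge0 y /\ (VP P y -> conv_hull (Ib b `&` VP P) y)].
  by move=> h y /h[].
apply: conv_hull_ind => [x y t t0 t1 [x0 xP] [y0 yP]|y yI]; last first.
  by split=> [|yP]; [case/IbE: yI | apply: sub_conv_hull].
have t1' : 0 <= 1 - t by lra.
split; first by apply: finsupp_ge0D; apply: finsupp_ge0Z.
(* At the endpoints one of the two points has weight 0 and need not lie in [VP P], so these cases
   are settled apart. *)
have [->|t_neq0] := eqVneq t 0.
  by rewrite scale0r add0r subr0 scale1r.
have [->|t_neq1] := eqVneq t 1.
  by rewrite subrr scale0r addr0 scale1r.
have t_gt0 : 0 < t by rewrite lt_neqAle eq_sym t_neq0.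
have t_lt1 : 0 < 1 - t by rewrite subr_gt0 lt_neqAle t_neq1.
move=> [_ zP]; case: (x0) (y0) => [fx px] [fy py].
have xy0 p : ~ P p -> x p = 0 /\ y p = 0.
  move=> /zP /eqP; rewrite !fctE /GRing.scale /= paddr_eq0 ?mulr_ge0 //.
  by rewrite !mulf_eq0 (gt_eqF t_gt0) (gt_eqF t_lt1) /= => /andP[/eqP ? /eqP].
apply: conv_hull_convex => //; [apply: xP|apply: yP]; split => // p /xy0[] //.
Qed.

(** If [pi p < 0], raising [y0] at [p] by a multiple [k] with [k%:R *: p] almost integral, and
    repairing the small error [d] with [s], lowers the left-hand side. Repetition drives it below
    [alpha]. *)
Lemma valid_tuple_pi_ge0 psi pi alpha : Ib b !=set0 ->
  valid_tuple b psi pi alpha -> forall p, 0 <= pi p.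
Proof.
move=> [y0 /IbE[[fy0 py0] ny0 zy0]] [_ v] p; rewrite leNgt; apply/negP => pi0.
pose e i : 'rV[R]_n := delta_mx 0 i.
pose C := \sum_i (`|psi (e i)| + `|psi (- e i)| + `|psi 0|).
have C0 : 0 <= C by apply: sumr_ge0 => i _; rewrite !addr_ge0.
(* This makes the repair cost, at most [eps * C], smaller than the gain [- pi p]. *)
pose eps := - pi p / (C + 1).
have C1 : 0 < C + 1 by lra.
have eps0 : 0 < eps by rewrite divr_gt0 // oppr_gt0.
have [k [z [k0 zZ zkp]]] := dirichlet_approximation p eps0.
pose d := z - k%:R *: p.
(* [s] must be nonnegative, so the sign of each error coordinate goes into the direction. A zero
   coordinate gives direction 0, whence the term [psi 0] in [C]. *)
pose a i := Num.sg (d 0 i) *: e i.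
pose s := \sum_i `|d 0 i| *: unit_at (a i).
have fs : finsupp s.
  by have [] := @wsum_sum R n R^o (fun=> 0) _ (index_enum 'I_n) (fun i => `|d 0 i|) a.
have s0 q : 0 <= s q.
  rewrite /s fct_sumE; apply: sumr_ge0 => i _.
  by rewrite mulr_ge0 // ler0n.
have sd : wsum id s = d.
  rewrite /s; have [_ ->] :=
    wsum_sum (id : _ -> 'rV[R]_n) (index_enum 'I_n) (fun i => `|d 0 i|) a.
  rewrite [RHS]row_sum_delta; apply: eq_bigr => i _.
  by rewrite /a scalerA mulrC -numEsg.
pose S : R := wsum (psi : _ -> R^o) s.
have S_le : S <= eps * C.
  rewrite /S /s; have [_ ->] :=
    wsum_sum (psi : _ -> R^o) (index_enum 'I_n) (fun i => `|d 0 i|) a.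
  rewrite mulr_sumr; apply: ler_sum => i _; rewrite /GRing.scale /=.
  apply: le_trans (ler_norm _) _; rewrite normrM normr_id.
  apply: ler_pM => //; first by have := zkp i; rewrite /d !mxE.
  have := normr_ge0 (psi (e i)); have := normr_ge0 (psi (- e i)).
  have := normr_ge0 (psi 0); rewrite /a.
  by case: sgrP => _; rewrite ?scale0r ?scale1r ?scaleN1r; lra.
have drift : S + k%:R * pi p < 0.
  have : eps * C < - pi p.
    by rewrite /eps mulrAC ltr_pdivrMr // ltr_pM2l ?oppr_gt0 // ltrDl ltr01.
  have k1 : 1 <= k%:R :> R by rewrite ler1n.
  have : k%:R * pi p <= pi p by nra.
  by lra.
(* The [m]-fold change stays in [Mb b] because [m%:R *: d + (m * k)%:R *: p = m%:R *: z] is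
   integral. *)
have bound (m : nat) : alpha <=
    m%:R * S + ((wsum (pi : _ -> R^o) y0 : R) + m%:R * (k%:R * pi p)).
  have fm : finsupp ((m * k)%:R *: unit_at p : 'rV[R]_n -> R).
    by apply: finsuppZ; exact: finsupp_unit_at.
  suff /v/tuple_ineqE : Mb b (m%:R *: s, y0 + (m * k)%:R *: unit_at p).
    have fp := @finsupp_unit_at R n p.
    by rewrite wsumD // !wsumZ // wsum_unit_at /GRing.scale /= natrM -mulrA.
  split => /=.
  - by apply: finsupp_ge0Z.
  - by apply: finsupp_ge0D => //; apply: finsupp_ge0Z => //; exact: finsupp_ge0_unit_at.
  - by move=> q; rewrite !fctE rpredD // rpredM ?natr_nat.
  have -> : \sum_(r \in [set: 'rV[R]_n]) (m%:R *: s) r *: r = m%:R *: d.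
    by rewrite -sd -wsumZ.
  have -> : \sum_(q \in [set: 'rV[R]_n]) (y0 + (m * k)%:R *: unit_at p) q *: q =
      wsum id y0 + (m * k)%:R *: p.
    rewrite -[RHS](_ : wsum id (y0 + (m * k)%:R *: unit_at p) = _) //.
    by rewrite wsumD // wsumZ ?wsum_unit_at //; exact: finsupp_unit_at.
  have -> : m%:R *: d + (wsum id y0 + (m * k)%:R *: p) - b =
      (wsum id y0 - b) + m%:R *: z.
    by rewrite /d scalerBr scalerA natrM addrACA addNr addr0 -addrA addrC.
  by apply: ZnD => //; exact: ZnMn.
set w : R := wsum _ y0 in bound; set g := S + k%:R * pi p in drift.
have := bound (Num.truncn ((w - alpha) / - g)).+1.
have := truncnS_gt ((w - alpha) / - g).
by rewrite ltr_pdivrMr ?oppr_gt0 // /g; lra.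
Qed.

End InfiniteGroup.

(** * Coordinates in R^P, dimension and spanning families *)

Section Restriction.
Context {R : realType} {n : nat} (P : {fset 'rV[R]_n}).
Implicit Types (y r : 'rV[R]_n -> R) (f : {ffun P -> R^o}).

Definition ext (T : Type) (f : P -> T) (x0 : T) : 'rV[R]_n -> T :=
  fun q => if insub q is Some p then f p else x0.

Lemma ext_in (T : Type) (f : P -> T) x0 (p : P) : ext f x0 (val p) = f p.
Proof. by rewrite /ext valK. Qed.

Lemma ext_notin (T : Type) (f : P -> T) x0 q : q \notin P -> ext f x0 q = x0.
Proof. by move=> qP; rewrite /ext insubN. Qed.

Lemma ext_VP f : VP [set` P] (ext f 0).
Proof. by apply: VP_finsupp => p pP; rewrite ext_notin. Qed.

Lemma restr_ext f : restr P (ext f 0) = f.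
Proof. by apply/ffunP => p; rewrite ffunE ext_in. Qed.

Lemma restrD y r : restr P (y + r) = restr P y + restr P r.
Proof. by apply/ffunP => p; rewrite !ffunE. Qed.

Lemma restrZ (c : R) y : restr P (c *: y) = c *: restr P y.
Proof. by apply/ffunP => p; rewrite !ffunE. Qed.

Lemma VPD (Q : set 'rV[R]_n) y r : VP Q y -> VP Q r -> VP Q (y + r).
Proof.
move=> [fy yQ] [fr rQ]; split; first exact: finsuppD.
by move=> p pQ; rewrite fctE yQ // rQ // addr0.
Qed.

Lemma VPZ (Q : set 'rV[R]_n) (c : R) y : VP Q y -> VP Q (c *: y).
Proof.
move=> [fy yQ]; split; first exact: finsuppZ.
by move=> p pQ; rewrite fctE yQ // scaler0.
Qed.

Lemma VP_unit_at p : p \in P -> VP [set` P] (unit_at p).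
Proof.
move=> pP; apply: VP_finsupp => q qP; rewrite /unit_at.
by case: eqP => // qp; rewrite qp pP in qP.
Qed.

Lemma VP_sum_unit_at y : VP [set` P] y -> y = \sum_(p <- P) y p *: unit_at p.
Proof.
move=> yP; apply/funext => q; rewrite fct_sumE.
transitivity (\sum_(p <- P) y p *: ((q == p)%:R : R^o)); last first.
  by apply: eq_bigr => p _.
rewrite -(wsum_VP _ yP); have [qP|qP] := boolP (q \in P); last first.
  rewrite (wsum_VP _ yP) big1_seq ?(yP.2 _ (negP qP)) // => p /andP[_ pP].
  by case: eqP => [qp|]; [rewrite qp pP in qP | rewrite scaler0].
rewrite (wsum_VP _ yP) (big_fsetD1 q) //= eqxx big1_seq ?addr0.
  by rewrite /GRing.scale /= mulr1.
by move=> p /andP[_]; rewrite !inE eq_sym => /andP[/negbTE -> _]; rewrite scaler0.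
Qed.

Lemma dim_restr : \dim {:{ffun P -> R^o}} = #|` P|.
Proof. by rewrite dimvf /dim /= muln1 cardfE. Qed.

Lemma orthant_has_dim (A : set {ffun P -> R^o}) (x : {ffun P -> R^o}) :
  (forall f, orthant P f -> A (x + f)) -> has_dim A #|` P|.
Proof.
move=> Ax; exists x, fullv; split; last exact: dim_restr.
apply/seteqP; split=> [y _|y _].
  by exists (y - x); rewrite /= ?memvf // addrC subrK.
move=> X [aX AX].
pose u := y - x.
(* Coordinatewise [u = 2 * max(u, 0) - |u|], an affine combination (weights 2 and -1) of points of
   the orthant. *)
pose a : {ffun P -> R^o} := [ffun p => Num.max (u p : R) 0].
pose c : {ffun P -> R^o} := [ffun p => `|(u p : R)|].
have -> : y = 2%:R *: (x + a) + (1 - 2%:R) *: (x + c).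
  apply/ffunP => p; rewrite !ffunE /u /GRing.scale /=.
  by case: (ger0P (y p - x p : R)) => h; ring.
apply: aX; apply: AX; apply: Ax => p; rewrite ffunE //.
by rewrite le_max lexx orbT.
Qed.

Lemma has_dim_aff_hull (A : set {ffun P -> R^o}) :
  has_dim A #|` P| -> aff_hull A = setT.
Proof.
move=> [x [U [-> dU]]]; have -> : U = fullv.
  by apply/eqP; rewrite eqEdim subvf dim_restr dU leqnn.
apply/seteqP; split => // y _.
by exists (y - x); rewrite /= ?memvf // addrC subrK.
Qed.

End Restriction.

(** As long as some vector of [A] is outside the span it is added to [s]. This raises the dimension,
    so induction on the codimension bound [k] ends. *)
Lemma exists_span (K : fieldType) (V : vectType K) (A : set V) :
  exists2 s : seq V, {in s, forall v, A v} & forall v, A v -> v \in span s.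
Proof.
suff H k (s : seq V) : {in s, forall v, A v} ->
    (\dim {:V} - \dim (span s) <= k)%N ->
    exists2 s : seq V, {in s, forall v, A v} & forall v, A v -> v \in span s.
  by apply: (H (\dim {:V}) [::]) => //; rewrite leq_subr.
elim: k s => [|k IH] s sA dk;
  (have [|/existsNP[v /not_implyP[Av /negP vs]]] :=
    pselect (forall v, A v -> v \in span s); first by exists s).
all: have lt_dim : (\dim (span s) < \dim (span (v :: s)))%N.
1,3: rewrite span_cons (ltn_leqif (dimv_leqif_sup (addvSr _ _))) subv_add negb_and.
1,2: by rewrite -memvE vs.
all: have le_dim := dimvS (subvf (span (v :: s))).
- by move: dk lt_dim le_dim; rewrite leqn0 subn_eq0; lia.
- apply: (IH (v :: s)); last by lia.
  by move=> w; rewrite inE => /orP[/eqP ->|/sA].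
Qed.

(** * From (a) to (b), from (b) to (c), and from (d) to (c) *)

Section Implications.
Context {R : realType} {n : nat} (b : 'rV[R]_n) (P : {fset 'rV[R]_n}).
Implicit Types (y r : 'rV[R]_n -> R) (p : 'rV[R]_n).

(** For [y] in [Ib b], raising [y p] by a multiple of [D] stays in [Ib b], and [y + l *: unit_at p]
    is on the segment to such a point. Convex combinations preserve the property. *)
Lemma conv_hull_ray (D : nat) p y (l : R) : (0 < D)%N -> Zn (D%:R *: p) ->
  conv_hull (Ib b) y -> 0 <= l -> conv_hull (Ib b) (y + l *: unit_at p).
Proof.
move=> D0 Dp yI; move: y yI l.
apply: conv_hull_ind => [x y t t0 t1 xP yP l l0|y /IbE[y0 ny yZ] l l0].
  have -> : t *: x + (1 - t) *: y + l *: unit_at p =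
      t *: (x + l *: unit_at p) + (1 - t) *: (y + l *: unit_at p).
    by rewrite !scalerDr addrACA -scalerDl [t + _]addrC subrK scale1r.
  by apply: conv_hull_convex; [| |exact: xP|exact: yP].
have D0' : 0 < D%:R :> R by rewrite ltr0n.
pose m := (Num.truncn (l / D%:R)).+1.
have mD0 : 0 < (m * D)%:R :> R by rewrite ltr0n muln_gt0.
have lm : l < (m * D)%:R by rewrite natrM -ltr_pdivrMr // truncnS_gt.
pose t := l / (m * D)%:R.
have -> : y + l *: unit_at p =
    t *: (y + (m * D)%:R *: unit_at p) + (1 - t) *: y.
  rewrite scalerDr scalerA /t divfK ?gt_eqF // addrAC -scalerDl.
  by rewrite [_ + (1 - _)]addrC subrK scale1r.
apply: conv_hull_convex.
- by rewrite divr_ge0 // ltW.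
- by rewrite ler_pdivrMr // mul1r ltW.
- apply: sub_conv_hull; apply/IbE.
  have fp := finsupp_unit_at p; split.
  + by apply: finsupp_ge0D => //; apply: finsupp_ge0Z => //; exact: finsupp_ge0_unit_at.
  + by move=> q; rewrite fctE rpredD // rpredM ?natr_nat.
  + rewrite wsumD ?(wsumZ, wsum_unit_at) //; [|by case: y0|exact: finsuppZ].
    by rewrite addrAC natrM -scalerA; apply: ZnD => //; exact: ZnMn.
- by apply: sub_conv_hull; apply/IbE.
Qed.

Lemma CP_addr y r : [set` P] `<=` Qn -> CP b [set` P] y -> VP [set` P] r ->
  (forall p, 0 <= r p) -> CP b [set` P] (y + r).
Proof.
move=> /common_denominator[D D0 DP] [yI yP] rP r0; split; last exact: VPD.
rewrite (VP_sum_unit_at rP) big_seq; elim/big_rec: _ => [|p z pP zI].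
  by rewrite addr0.
by rewrite addrCA addrC; apply: (conv_hull_ray D0 (DP p pP)).
Qed.

Lemma rational_rec_cone : CP b [set` P] !=set0 -> [set` P] `<=` Qn ->
  rec_cone (CP_R b P) = orthant P.
Proof.
move=> [y yC] PQ; apply/seteqP; split=> [r rC p|r r0 _ [x xC <-] l l0].
  rewrite leNgt; apply/negP => rp0.
  have yp := CP_ge0 (val p) yC.
  (* This step length brings the coordinate [p] to exactly -1. *)
  have l0 : 0 <= (y (val p) + 1) / - r p by rewrite divr_ge0 ?oppr_ge0 ?ltW //; lra.
  have [x xC] := rC _ (ex_intro2 _ _ y yC erefl) _ l0.
  move=> /ffunP/(_ p); rewrite !ffunE /GRing.scale /= => xp.
  have := CP_ge0 (val p) xC; rewrite xp invrN mulrN mulNr divfK ?lt_eqF //.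
  lra.
exists (x + l *: ext r 0); last by rewrite restrD restrZ restr_ext.
apply: CP_addr => //; first by apply: VPZ; exact: ext_VP.
move=> q; rewrite fctE mulr_ge0 // /ext.
by case: insubP => // p _ _; exact: r0.
Qed.

Lemma rec_cone_has_dim : CP b [set` P] !=set0 ->
  rec_cone (CP_R b P) = orthant P -> has_dim (CP_R b P) #|` P|.
Proof.
move=> [y yC] recE; apply: (@orthant_has_dim _ _ _ _ (restr P y)) => r.
rewrite -recE => /(_ (restr P y) (ex_intro2 _ _ y yC erefl) 1 ler01).
by rewrite scale1r.
Qed.

Lemma Gb_has_dim : CP b [set` P] !=set0 ->
  CP b [set` P] = Gb b `&` VP [set` P] -> has_dim (CP_R b P) #|` P|.
Proof.
move=> C0 CE; have I0 := Ib_neq0 C0; case: C0 => y yC.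
apply: (@orthant_has_dim _ _ _ _ (restr P y)) => r r0.
exists (y + ext r 0); last by rewrite restrD restr_ext.
have e0 q : 0 <= ext r 0 q by rewrite /ext; case: insubP => // p _ _; exact: r0.
rewrite CE in yC *; case: yC => /GbE[y0 yG] yP; split; last first.
  by apply: VPD => //; exact: ext_VP.
have fe := (ext_VP r).1; apply/GbE; split; first by apply: finsupp_ge0D.
move=> psi pi alpha v; rewrite wsumD //; last by case: y0.
apply: le_trans (yG _ _ _ v) _; rewrite lerDl wsum_ge0 //.
exact: valid_tuple_pi_ge0 I0 v.
Qed.

End Implications.

(** * From (c) to (a): full dimension forces rationality *)

Lemma aff_hull_sub {R : realType} {V : vectType R} (v0 : V) (U : {vspace V})
    (A : set V) :
  (forall f, A f -> f - v0 \in U) -> aff_hull A `<=` [set f | f - v0 \in U].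
Proof.
move=> AU; apply: smallest_sub => //= f g t fU gU /=.
have := memvD (memvZ t fU) (memvZ (1 - t) gU); congr (_ \in U).
by rewrite !scalerBr addrACA -opprD -scalerDl [t + _]addrC subrK scale1r.
Qed.

Section FullDimension.
Context {R : realType} {n : nat} (b : 'rV[R]_n) (P : {fset 'rV[R]_n}).
Implicit Types (y r : 'rV[R]_n -> R) (p : 'rV[R]_n).

(** Differences of integer points of C^P span R^P. As rows of [M] they send each coordinate vector
    [x] of the points of [P] to an integer vector [N], and a rational left inverse of [M] then
    recovers [x]. *)
Lemma has_dim_rational : CP b [set` P] !=set0 ->
  has_dim (CP_R b P) #|` P| -> [set` P] `<=` Qn.
Proof.
move=> C0 /has_dim_aff_hull affE.
have [y0 [y0I y0P]] : Ib b `&` VP [set` P] !=set0.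
  case: C0 => y /CP_sub_conv_hull yC; apply: contrapT => I0.
  by apply: (@conv_hull_ind _ _ _ set0 _ _ y yC) => // z zI; apply: I0; exists z.
pose A : set {ffun P -> R^o} :=
  [set restr P y - restr P y0 | y in Ib b `&` VP [set` P]].
have [s sA As] := exists_span A.
have nat_int (x : R) : x \is a Num.nat -> x \is a Num.int.
  by move=> /natrP[m ->]; exact: natr_int.
have spanT : span s = fullv.
  apply/eqP; rewrite eqEsubv subvf; apply/subvP => v _.
  have : aff_hull (CP_R b P) (v + restr P y0) by rewrite affE.
  move=> /(aff_hull_sub (v0 := restr P y0) (U := span s)) /=; rewrite addrK; apply.
  move=> _ [z /CP_sub_conv_hull zC <-].
  suff /(_ _ zC) : conv_hull (Ib b `&` VP [set` P]) `<=`
    [set y | restr P y - restr P y0 \in span s] by [].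
  apply: conv_hull_ind => [x y t _ _ xU yU /=|y yI /=]; last by apply: As; exists y.
  have := memvD (memvZ t xU) (memvZ (1 - t) yU).
  congr (_ \in span s); rewrite restrD !restrZ !scalerBr addrACA -opprD -scalerDl.
  by rewrite [t + _]addrC subrK scale1r.
pose k := #|{: P}|; pose e (j : 'I_k) : P := enum_val j.
pose ti := in_tuple s.
pose M : 'M[rat]_(size s, k) := \matrix_(l, j) (Num.floor (ti`_l (e j) : R))%:~R.
have sZ (l : 'I_(size s)) (q : P) : (ti`_l q : R) \is a Num.int.
  have /sA[y [/IbE[_ ny _] _] <-] : ti`_l \in s by exact: mem_nth.
  case/IbE: y0I => _ ny0 _.
  by rewrite !ffunE rpredB ?nat_int.
have ME l j : map_mx ratr M l j = (ti`_l (e j) : R).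
  by rewrite !mxE ratr_int floorK.
(* Rank is unchanged by the embedding of the rationals into [R]. Over [R], the coordinates of the
   standard basis in the spanning family form a left inverse. *)
have /row_fullP[C CM] : row_full M.
  rewrite -(row_full_map (@ratr R)); apply/row_fullP.
  pose d (j : 'I_k) : {ffun P -> R^o} := [ffun q => (q == e j)%:R].
  exists (\matrix_(j, l) (coord ti l (d j) : R)); apply/matrixP => j j'.
  rewrite !mxE; transitivity (d j (e j') : R).
    rewrite [in RHS](@coord_span _ _ _ ti (d j)) ?spanT ?memvf //.
    rewrite sum_ffunE; apply: eq_bigr => l _; rewrite ME mxE.
    by rewrite !ffunE.
  by rewrite ffunE (inj_eq enum_val_inj) eq_sym.
move=> p pP i.
pose N : 'cV[rat]_(size s) :=
  \col_l (Num.floor (\sum_j (ti`_l (e j) : R) * (val (e j) : 'rV_n) 0 i))%:~R.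
pose x : 'cV[R]_k := \col_j (val (e j) : 'rV_n) 0 i.
have MN : map_mx ratr M *m x = map_mx ratr N.
  apply/matrixP => l l'; rewrite !mxE ratr_int floorK.
    by apply: eq_bigr => j _; rewrite ME mxE.
  have /sA[y [/IbE[_ _ yZ] yP] <-] : ti`_l \in s by exact: mem_nth.
  have wE z : VP [set` P] z ->
      \sum_j (restr P z (e j) : R) * (val (e j) : 'rV_n) 0 i = wsum id z 0 i.
    move=> zP; rewrite (wsum_VP _ zP) summxE big_seq_fsetE /= (reindex e) /=.
      by apply: eq_bigr => j _; rewrite ffunE mxE.
    by apply: onW_bij; exact: enum_val_bij.
  (* The shift [b] cancels in the difference of two members of the coset. *)
  have -> : \sum_j ((restr P y - restr P y0) (e j) : R) * (val (e j) : 'rV_n) 0 i =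
      (wsum id y - b) 0 i - (wsum id y0 - b) 0 i.
    transitivity (wsum id y 0 i - wsum id y0 0 i); last by rewrite !mxE; ring.
    rewrite -!wE // -sumrB; apply: eq_bigr => j _.
    by rewrite -mulrBl !ffunE.
  by rewrite rpredB //; case/IbE: y0I.
have xE : x = map_mx ratr (C *m N).
  by rewrite map_mxM -MN mulmxA -map_mxM CM map_mx1 mul1mx.
exists ((C *m N) (enum_rank [` pP]%fset) 0) => //.
transitivity (x (enum_rank [` pP]%fset) 0); first by rewrite xE [RHS]mxE.
by rewrite mxE /e enum_rankK.
Qed.

End FullDimension.

(** * From (a) to (d): separating valid tuples for rational [P] *)

Lemma coset_int_gap {R : realType} (c : R) :
  exists2 delta : R, 0 < delta &
    forall u, u - c \is a Num.int -> u != 0 -> delta <= `|u|.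
Proof.
have [cZ|cZ] := boolP (c \is a Num.int).
  exists 1 => // u uZ; apply: norm_intr_ge1.
  by rewrite -(subrK c u) rpredD.
pose f := c - (Num.floor c)%:~R.
have : 0 <= f < 1 by have := floor_itv c; rewrite intrD /f; lra.
have f0 : f != 0.
  by apply: contra cZ; rewrite subr_eq0 => /eqP ->; exact: intr_int.
move=> /andP[f_ge0 f1]; have {f_ge0}f0 : 0 < f by rewrite lt_neqAle eq_sym f0.
(* Every [u] in the coset is [f + m] with [m] an integer: [m >= 0] gives [|u| >= f], and [m <= -1]
   gives [|u| >= 1 - f]. *)
exists (Num.min f (1 - f)); first by rewrite lt_min f0 subr_gt0.
move=> u uZ _; rewrite ge_min.
have /intrP[m uE] : u - f \is a Num.int.
  by rewrite /f opprB addrCA addrC rpredD ?intr_int.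
have [m0|m0] := leP 0 m.
  have : 0 <= m%:~R :> R by rewrite ler0z.
  by rewrite ler_normr; lra.
have : m%:~R <= (-1)%:~R :> R by rewrite ler_int; lia.
by rewrite mulrNz mulr1z => ?; apply/orP; right; rewrite ler_normr; lra.
Qed.

Section Separation.
Context {R : realType} {n : nat} (b : 'rV[R]_n) (P : {fset 'rV[R]_n}).
Implicit Types (y r x : 'rV[R]_n -> R) (p : 'rV[R]_n).

Lemma wsum_le (h h' : 'rV[R]_n -> R^o) y : finsupp_ge0 y ->
  (forall p, (h p : R) <= h' p) -> (wsum h y : R) <= wsum h' y.
Proof.
move=> [/finsuppP[A yA] y0] hh; rewrite !(@wsumE _ _ _ _ _ A) //.
by apply: ler_sum => p _; rewrite ler_wpM2l.
Qed.

Lemma norm_wsum_coord y i : finsupp_ge0 y ->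
  `|(wsum id y) 0 i| <= (wsum (fun p => `|p 0 i| : R^o) y : R).
Proof.
move=> [/finsuppP[A yA] y0]; rewrite !(@wsumE _ _ _ _ _ A) // summxE.
apply: le_trans (ler_norm_sum _ _ _) _; apply: ler_sum => p _.
by rewrite mxE normrM ger0_norm.
Qed.

(* Nonzero elements of the coset [b + (1/D) Z^n] are bounded away from 0, so a
   large multiple of a norm works. *)
Lemma exists_psi (D : nat) : (0 < D)%N ->
  exists2 psi : 'rV[R]_n -> R, (forall p, 0 <= psi p) &
    forall s, finsupp_ge0 s -> Zn (D%:R *: (wsum id s - b)) ->
      wsum id s != 0 -> 1 <= (wsum (psi : _ -> R^o) s : R).
Proof.
move=> D0; have D0' : 0 < D%:R :> R by rewrite ltr0n.
pose gap i := cid2 (coset_int_gap (D%:R * b 0 i)).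
(* The gap bounds [D] times a nonzero coordinate, so [K i] times that coordinate is at least 1 in
   absolute value. *)
pose K i := D%:R / s2val (gap i).
have gap0 i : 0 < s2val (gap i) by exact: (s2valP (gap i)).
have K0 i : 0 < K i by rewrite divr_gt0.
pose psi (r : 'rV[R]_n) := \sum_i K i * `|r 0 i|.
exists psi => [r|s s0 sZ sn0].
  by apply: sumr_ge0 => i _; rewrite mulr_ge0 // ltW.
have [i si] : exists i, (wsum id s) 0 i != 0.
  apply/existsP; apply: contraNT sn0; rewrite negb_exists => /forallP h.
  by apply/eqP/rowP => i; rewrite mxE; apply/eqP; rewrite -[_ == _]negbK h.
have gap_le : s2val (gap i) <= D%:R * `|(wsum id s) 0 i|.
  rewrite -[X in _ <= X * _](gtr0_norm D0') -normrM; apply: (s2valP' (gap i)).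
    by have := sZ i; rewrite !mxE mulrBr.
  by rewrite mulf_neq0 // gt_eqF.
apply: (@le_trans _ _ (K i * `|(wsum id s) 0 i|)).
  by rewrite /K mulrAC ler_pdivlMr // mul1r.
apply: (@le_trans _ _ (wsum (fun p => K i * `|p 0 i| : R^o) s : R)).
  apply: le_trans (ler_wpM2l (ltW (K0 i)) (norm_wsum_coord i s0)) _.
  have -> : wsum (fun p => K i * `|p 0 i| : R^o) s =
      K i * (wsum (fun p => `|p 0 i| : R^o) s : R) :> R; last by [].
  case: s0 => /finsuppP[A sA] _; rewrite !(@wsumE _ _ _ _ _ A) // mulr_sumr.
  by apply: eq_bigr => p _; rewrite mulrCA.
apply: wsum_le => // r; rewrite /psi (bigD1 i) //= lerDl.
by apply: sumr_ge0 => j _; rewrite mulr_ge0 // ltW.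
Qed.

Section Denominator.
Context (D' : nat) (D := D'.+1) (DP : forall p, p \in P -> Zn (D%:R *: p)).

(** Coefficients taken modulo [D]; indexing by a finite type leaves only finitely many candidates to
    separate from. *)
Definition residue (g : {ffun P -> 'I_D}) : 'rV[R]_n -> R :=
  ext (fun p : P => (g p : nat)%:R) 0.

(** Removing multiples of [D] from the coefficients changes the sum by a vector of Z^n, since
    [D%:R *: p] is integral on [P]. *)
Lemma Ib_residue y : Ib b y -> VP [set` P] y ->
  exists g, [/\ Ib b (residue g), VP [set` P] (residue g) &
    forall p, residue g p <= y p].
Proof.
move=> /IbE[[fy y0] ny yZ] yP.
pose m (p : P) := Num.truncn (y (val p)).
have ym (p : P) : y (val p) = (m p)%:R.
  by rewrite /m; case/natrP: (ny (val p)) => k ->; rewrite natrK.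
pose g : {ffun P -> 'I_D} := [ffun p => inord (m p %% D)].
pose q := ext (fun p : P => (m p %/ D)%:R : R) 0.
have gP : VP [set` P] (residue g).
  by apply: VP_finsupp => p pP; rewrite /residue ext_notin.
have qP : VP [set` P] q by apply: VP_finsupp => p pP; rewrite /q ext_notin.
have yE : y = residue g + D%:R *: q.
  apply/funext => p; rewrite !fctE; have [pP|pP] := boolP (p \in P); last first.
    by rewrite (yP.2 _ (negP pP)) (gP.2 _ (negP pP)) (qP.2 _ (negP pP)) scaler0 addr0.
  rewrite -[p]/(val [` pP]%fset) /residue /q !ext_in ym ffunE inordK ?ltn_pmod //.
  by rewrite /GRing.scale /= -natrM -natrD mulnC addnC -divn_eq.
have q0 p : 0 <= q p.
  by rewrite /q /ext; case: insubP => // *; rewrite ler0n.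
exists g; split => //.
  apply/IbE; split.
  - split; first by case: gP.
    by move=> p; rewrite /residue /ext; case: insubP => // *; rewrite ler0n.
  - by move=> p; rewrite /residue /ext; case: insubP => [*|_]; rewrite ?natr_nat ?rpred0.
  have -> : wsum id (residue g) - b = (wsum id y - b) - wsum id (D%:R *: q).
    rewrite yE wsumD; [|by case: gP|by apply: finsuppZ; case: qP].
    by rewrite [_ + _ - b]addrAC addrK.
  apply: ZnD => //; apply: ZnN; rewrite (wsum_VP _ (VPZ _ qP)).
  rewrite big_seq; elim/big_rec: _ => [|p z pP zZ]; first exact: Zn0.
  apply: ZnD => //; rewrite (_ : (D%:R *: q) p = q p * D%:R) -?scalerA; last first.
    by rewrite [RHS]mulrC.
  rewrite -[p]/(val [` pP]%fset) /q ext_in; apply: ZnMn; exact: DP.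
by move=> p; rewrite yE fctE lerDl mulr_ge0.
Qed.

(** Three cases give at least 1: a nonzero entry of [y] outside [P] pays through [pi = 1]; a nonzero
    continuous sum lies in b + (1/D) Z^n and pays through [psi]; otherwise [y] is in [Ib b] and
    dominates a residue. *)
Lemma valid_tuple_of_residues x : (forall p, p \in P -> 0 <= x p) ->
  (forall g, Ib b (residue g) -> 1 <= (wsum (x : _ -> R^o) (residue g) : R)) ->
  exists psi, valid_tuple b psi (fun p => if p \in P then x p else 1) 1.
Proof.
move=> x0 x1; have [psi psi0 psi1] := @exists_psi D isT.
exists psi; split; first by constructor 3.
set pi := fun _ => _.
have pi0 p : 0 <= pi p by rewrite /pi; case: ifP => // /x0.
move=> [s y] [/= s0 y0 ny syZ]; apply/tuple_ineqE.
have psis : 0 <= (wsum (psi : _ -> R^o) s : R) by apply: wsum_ge0 => //; case: s0.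
have piy : 0 <= (wsum (pi : _ -> R^o) y : R) by apply: wsum_ge0 => //; case: y0.
have [yP|/existsNP[p /not_implyP[/negP pP /eqP yp]]] :=
  pselect (forall p, ~ p \in P -> y p = 0); last first.
  suff : 1 <= (wsum (pi : _ -> R^o) y : R) by lra.
  have y1 : 1 <= y p.
    by move: yp; case/natrP: (ny p) => k ->; rewrite pnatr_eq0 ler1n lt0n.
  have fp := @finsupp_unit_at R n p.
  rewrite -[y](subrK (unit_at p)) wsumD //; last first.
    by rewrite -scaleN1r; apply: finsuppD; [case: y0|exact: finsuppZ].
  rewrite wsum_unit_at /pi (negbTE pP) lerDr; apply: wsum_ge0 => // q.
  rewrite fctE /unit_at subr_ge0; case: eqP => [->|_] //.
  by case: y0.
have {}yP : VP [set` P] y by split => //; case: y0.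
have [s_eq0|s_neq0] := eqVneq (wsum id s) 0; last first.
  suff : 1 <= (wsum (psi : _ -> R^o) s : R) by lra.
  apply: psi1 => //.
  have -> : D%:R *: (wsum id s - b) =
    D%:R *: (wsum id s + wsum id y - b) - D%:R *: wsum id y.
    by rewrite -scalerBr [_ + _ - b]addrAC addrK.
  apply: ZnD; first exact: ZnMn.
  apply: ZnN; rewrite (wsum_VP _ yP) scaler_sumr big_seq.
  elim/big_rec: _ => [|p z pP zZ]; first exact: Zn0.
  apply: ZnD => //; rewrite scalerA mulrC -scalerA.
  by case/natrP: (ny p) => k ->; apply: ZnMn; exact: DP.
suff : 1 <= (wsum (pi : _ -> R^o) y : R) by lra.
have yI : Ib b y.
  by apply/IbE; split => //; move: syZ; rewrite -!/(wsum _ _) s_eq0 add0r.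
have [g [gI gP gy]] := Ib_residue yI yP.
apply: le_trans (x1 g gI) _.
rewrite !(wsum_VP _ gP) !(wsum_VP _ yP) big_seq [leRHS]big_seq.
by apply: ler_sum => p pP; rewrite /pi pP ler_wpM2r ?x0.
Qed.

End Denominator.
End Separation.

(** Used to show that the second alternative of Gordan's theorem puts [y] in C^P. A positive
    combination is either a multiple of [c - y] with [c] in C^P, rays being absorbed into [c], or a
    nonnegative ray that is nonzero on [P]. Vanishing on [P] excludes the ray and forces [c = y]. *)
Lemma pos_comb_CP {R : realType} {n : nat} (b : 'rV[R]_n) (P : {fset 'rV[R]_n})
    (y : 'rV[R]_n -> R) (L : seq ('rV[R]_n -> R)) v :
  [set` P] `<=` Qn -> VP [set` P] y ->
  (forall a, a \in L -> CP b [set` P] (a + y) \/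
     exists2 p, p \in P & a = unit_at p) ->
  pos_comb L v -> (forall p, p \in P -> v p = 0) -> CP b [set` P] y.
Proof.
move=> PQ yP LP vL v0.
pose up (w : 'rV[R]_n -> R) := exists (t : R) c,
  [/\ 0 < t, CP b [set` P] c & w = t *: (c - y)].
pose ray (w : 'rV[R]_n -> R) := [/\ VP [set` P] w, forall p, 0 <= w p &
  exists2 p, p \in P & 0 < w p].
have up_ray w w' : up w -> VP [set` P] w' -> (forall p, 0 <= w' p) -> up (w + w').
  move=> [t [c [t0 cC ->]]] wP w0; exists t, (c + t^-1 *: w'); split => //.
    apply: CP_addr => //; first exact: VPZ.
    by move=> p; rewrite fctE mulr_ge0 // invr_ge0 ltW.
  by rewrite addrAC [RHS]scalerDr scalerA mulfV ?gt_eqF // scale1r.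
suff [|[wP _ [p pP]]] : up v \/ ray v.
- move=> [t [c [t0 cC vE]]]; suff <- : c = y by [].
  apply/funext => p; have [pP|pP] := boolP (p \in P); last first.
    by rewrite (yP.2 _ (negP pP)) (cC.2.2 _ (negP pP)).
  have /eqP := v0 p pP; rewrite vE fctE scaler_eq0 gt_eqF //=.
  by rewrite fctE subr_eq0 => /eqP.
- by rewrite v0 ?ltxx.
elim: vL {v0} => {v} [v /LP[vC|[p pP ->]]|v w _ IHv _ IHw|c v c0 _ IHv].
- by left; exists 1, (v + y); rewrite ltr01 scale1r addrK.
- right; split; first exact: VP_unit_at.
    by move=> q; exact: ler0n.
  by exists p; rewrite // /unit_at eqxx ltr01.
- case: IHv IHw => [uv|rv] [uw|rw].
  + left; case: uv uw => [t [x [t0 xC ->]]] [u [z [u0 zC ->]]].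
    have tu0 : 0 < t + u by rewrite addr_gt0.
    (* The weighted mean of [x] and [z] with weights [t] and [u]. *)
    exists (t + u), ((t / (t + u)) *: x + (1 - t / (t + u)) *: z); split => //.
      have [xI xP] := xC; have [zI zP] := zC.
      split; last by apply: VPD; exact: VPZ.
      apply: conv_hull_convex => //; first by rewrite divr_ge0 ?ltW.
      by rewrite ler_pdivrMr // mul1r lerDl ltW.
    have t1 : (t + u) * (1 - t / (t + u)) = u by field; rewrite gt_eqF.
    rewrite [RHS]scalerBr [X in _ = X - _]scalerDr !scalerA t1.
    rewrite mulrCA mulfV ?gt_eqF // mulr1.
    by rewrite !scalerBr scalerDl opprD addrACA.
  + by left; case: rw => wP w0 _; exact: up_ray.
  + by left; case: rv => vP v0 _; rewrite addrC; exact: up_ray.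
  + right; case: rv rw => vP v0 [p pP vp] [wP w0 _].
    split; [exact: VPD|by move=> q; rewrite fctE addr_ge0|].
    by exists p; rewrite // fctE ltr_pwDl.
- case: IHv => [[t [x [t0 xC ->]]]|[vP v0 [p pP vp]]].
    by left; exists (c * t), x; rewrite mulr_gt0 // scalerA.
  right; split; [exact: VPZ|by move=> q; rewrite fctE mulr_ge0 // ltW|].
  by exists p; rewrite // fctE mulr_gt0.
Qed.

Lemma rational_Gb_sub_CP {R : realType} {n : nat} (b : 'rV[R]_n)
    (P : {fset 'rV[R]_n}) :
  [set` P] `<=` Qn -> Gb b `&` VP [set` P] `<=` CP b [set` P].
Proof.
move=> PQ y [/GbE[y0 yG] yP]; have [[//|D'] _ DP] := common_denominator PQ.
pose res := @residue R n P D'.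
have resP g : VP [set` P] (res g).
  by apply: VP_finsupp => p pP; rewrite /res /residue ext_notin.
pose G := [seq g <- enum {ffun P -> 'I_D'.+1} | `[< Ib b (res g) >]].
pose L := [seq res g - y | g <- G] ++ [seq unit_at p | p <- P].
have LVP a : a \in L -> VP [set` P] a.
  rewrite mem_cat => /orP[] /mapP[z zP ->]; last exact: VP_unit_at.
  by rewrite -scaleN1r; apply: VPD => //; exact: VPZ.
(* Positivity on [L] says that [x] is positive on [P] and takes a smaller value at [y] than at every
   residue in [Ib b]. *)
have [[x xL]|[v vL v0]] := gordan L (fset_uniq P); last first.
  apply: pos_comb_CP vL v0 => // a; rewrite mem_cat => /orP[] /mapP[z zP ->].
    left; rewrite subrK; split => //; apply: sub_conv_hull.
    by move: zP; rewrite mem_filter => /andP[/asboolP].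
  by right; exists z.
have {}xL a : a \in L -> 0 < (wsum (x : _ -> R^o) a : R).
  by move=> aL; have := xL a aL; rewrite (wsum_VP _ (LVP a aL)).
have x0 p : p \in P -> 0 < x p.
  move=> pP; have /xL : unit_at p \in L by rewrite mem_cat map_f ?orbT.
  by rewrite wsum_unit_at.
have fin z : VP [set` P] z -> finsupp z by case.
(* Dividing [x] by a separating level [c] makes the right-hand side 1, as a valid tuple requires.
   The list [G] may be empty. *)
have [c [yc cG]] : exists c,
    (forall a, a \in [:: wsum (x : _ -> R^o) y : R] -> a < c) /\
    (forall a, a \in [seq wsum (x : _ -> R^o) (res g) : R | g <- G] -> c < a).
  apply: exists_between => a d; rewrite inE => /eqP -> /mapP[g gG ->].
  have /xL : res g - y \in L by rewrite mem_cat (map_f (fun g => res g - y) gG).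
  rewrite wsumD; [|exact: fin|by rewrite -scaleN1r; apply: finsuppZ; exact: fin].
  by rewrite -scaleN1r wsumZ ?scaleN1r ?subr_gt0 //; exact: fin.
have {}yc := yc _ (mem_head _ _).
have c0 : 0 < c.
  apply: le_lt_trans yc; rewrite (wsum_VP _ yP) big_seq; apply: sumr_ge0 => p pP.
  by rewrite mulr_ge0 ?(ltW (x0 p pP)) //; case: y0.
have xc z : VP [set` P] z ->
    (wsum ((fun p => x p / c) : _ -> R^o) z : R) = wsum (x : _ -> R^o) z / c.
  move=> zP; rewrite !(wsum_VP _ zP) mulr_suml.
  by apply: eq_bigr => p _; rewrite /GRing.scale /= mulrA.
have [psi v] : exists psi,
    valid_tuple b psi (fun p => if p \in P then x p / c else 1) 1.
  apply: (valid_tuple_of_residues DP) => [p pP|g gI].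
    by rewrite divr_ge0 ?ltW ?x0.
  rewrite xc // ler_pdivlMr // mul1r ltW //; apply/cG/mapP; exists g => //.
  by rewrite mem_filter mem_enum andbT; apply/asboolP.
have := yG _ _ _ v; rewrite (wsum_VP _ yP).
rewrite (_ : \sum_(p <- P) _ = (wsum (x : _ -> R^o) y / c : R)).
  by rewrite ler_pdivlMr // mul1r leNgt yc.
rewrite -xc // (wsum_VP _ yP) big_seq [RHS]big_seq.
by apply: eq_bigr => p ->.
Qed.

Theorem theorem4p3 (R : realType) (n : nat) (b : 'rV[R]_n)
    (P : {fset 'rV[R]_n}) :
  ~ Zn b ->
  CP b [set` P] !=set0 ->
  [<-> [set` P] `<=` Qn;
       rec_cone (CP_R b P) = orthant P;
       has_dim (CP_R b P) #|` P|;
       CP b [set` P] = Gb b `&` VP [set` P]].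
Proof.
move=> _ C0; split; first exact: rational_rec_cone.
split; first exact: rec_cone_has_dim.
(* The cycle closes from (d) to (a) through (c); the remaining step from (c) to (d) goes through
   (a). *)
split; last by move/(Gb_has_dim C0); exact: has_dim_rational.
move=> /(has_dim_rational C0) PQ; apply/seteqP.
by split; [exact: CP_sub_Gb | exact: rational_Gb_sub_CP].
Qed.
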